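(* Consider an interval $[\sigma,\tau]$ in the permutation pattern poset, let $\alpha$ and $\gamma$ be indecomposable permutations, and let $\beta$ and $\delta$ be skew indecomposable permutations. (a) If $\alpha\oplus\sigma\not\le\tau$, then $[\sigma,\tau]\cong[\alpha\oplus\sigma,\ \alpha\oplus\tau]$. (b) If $\beta\ominus\sigma\not\le\tau$, then $[\sigma,\tau]\cong[\beta\ominus\sigma,\ \beta\ominus\tau]$. (c) If $\sigma\oplus\gamma\not\le\tau$, then $[\sigma,\tau]\cong[\sigma\oplus\gamma,\ \tau\oplus\gamma]$. (d) If $\sigma\ominus\delta\not\le\tau$, then $[\sigma,\tau]\cong[\sigma\ominus\delta,\ \tau\ominus\delta]$. Here $\cong$ denotes isomorphism of posets.
   Context: The permutation pattern poset is the set of all permutations of $\{1,\dots,n\}$, $n>0$ (written as words), ordered by pattern containment: $\sigma\le\tau$ if $\tau$ has a subsequence whose letters appear in the same relative order of size as those of $\sigma$. $[\sigma,\tau]=\{\pi:\sigma\le\pi\le\tau\}$. The direct sum $\alpha\oplus\beta$ is the concatenation of $\alpha$ and $\beta'$, where $\beta'$ is obtained from $\beta$ by adding to each of its letters the largest letter of $\alpha$. The skew sum $\alpha\ominus\beta$ is the concatenation of $\alpha'$ and $\beta$, where $\alpha'$ is obtained from $\alpha$ by adding to each of its letters the largest letter of $\beta$. A permutation is indecomposable (resp. skew indecomposable) if it is not the direct sum (resp. skew sum) of two nonempty permutations. *)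

(* Defs.v *)
From HB Require Import structures.
From mathcomp Require Import all_boot all_order.

Set Implicit Arguments.
Unset Strict Implicit.
Unset Printing Implicit Defensive.

Import Order.Theory.

(* Words over nat, nonempty, using each of the letters 1, ..., n exactly once. *)
Definition is_permutation (w : seq nat) : bool :=
  (0 < size w) && perm_eq w (iota 1 (size w)).

Record permutation := Permutation {
  word :> seq nat;
  wordP : is_permutation word
}.

HB.instance Definition _ := [isSub for word].
HB.instance Definition _ := [Choice of permutation by <:].

(* The letters are distinct in every use below, so comparing [<] suffices. *)
Definition order_isomorphic (u v : seq nat) : bool :=
  (size u == size v) &&
  [forall i : 'I_(size u), forall j : 'I_(size u),
     (nth 0 u i < nth 0 u j) == (nth 0 v i < nth 0 v j)].

(* The subsequences of [t] are the words [mask m t]; see [contains_patternP]. *)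
Definition contains_pattern (s t : permutation) : bool :=
  [exists m : (size t).-tuple bool, order_isomorphic (mask m t) s].

Lemma contains_patternP (s t : permutation) :
  reflect (exists2 u : seq nat, subseq u t & order_isomorphic u s)
          (contains_pattern s t).
Proof.
apply: (iffP existsP) => [[m hm]|[u /subseqP[m sm ->] hu]].
  by exists (mask m t); first exact: mask_subseq.
by exists (tcast sm (in_tuple m)); rewrite val_tcast.
Qed.

Lemma order_isomorphicP (u v : seq nat) :
  reflect (size u = size v /\ forall i j, i < size u -> j < size u ->
             (nth 0 u i < nth 0 u j) = (nth 0 v i < nth 0 v j))
          (order_isomorphic u v).
Proof.
apply: (iffP andP) => [[/eqP -> /forallP h]|[-> h]]; split => //.
  move=> i j hi hj; have /forallP/(_ (Ordinal hj))/eqP // := h (Ordinal hi).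
by apply/forallP => i; apply/forallP => j; apply/eqP/h.
Qed.

Lemma order_isomorphic_refl : reflexive order_isomorphic.
Proof. by move=> u; apply/order_isomorphicP. Qed.

Lemma order_isomorphic_trans : transitive order_isomorphic.
Proof.
move=> v u w /order_isomorphicP[suv huv] /order_isomorphicP[svw hvw].
apply/order_isomorphicP; split=> [|i j hi hj]; first by rewrite suv.
by rewrite huv // hvw // -suv.
Qed.

Lemma order_isomorphic_mask m u v :
  order_isomorphic u v -> order_isomorphic (mask m u) (mask m v).
Proof.
move=> /order_isomorphicP[suv huv]; set I := mask m (iota 0 (size u)).
have EI w : size w = size u -> mask m w = [seq nth 0 w i | i <- I].
  by move=> sw; rewrite -[in LHS](mkseq_nth 0 w) sw /mkseq map_mask.
have ltI i : i < size I -> nth 0 I i < size u.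
  by move=> hi; have := mem_mask (mem_nth 0 hi); rewrite mem_iota.
rewrite (EI u) // (EI v) //; apply/order_isomorphicP.
rewrite !size_map; split=> // i j hi hj.
by rewrite !(nth_map 0) // huv // ltI.
Qed.

Lemma nth_permutation (s : permutation) i : i < size s ->
  nth 0 s i = (count (fun j => nth 0 s j < nth 0 s i) (iota 0 (size s))).+1.
Proof.
move=> hi; case/andP: (wordP s) => _ ps; set k := nth 0 s i.
have : k \in iota 1 (size s) by rewrite -(perm_mem ps) mem_nth.
rewrite mem_iota add1n ltnS => /andP[k0 kn].
have -> : count (fun j => nth 0 s j < k) (iota 0 (size s)) = count (ltn^~ k) s.
  by rewrite -[in RHS](mkseq_nth 0 s) count_map.
rewrite (permP ps) -[in iota _ _](subnKC (leq_trans (leq_pred k) kn)) iotaD.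
rewrite count_cat add1n prednK //.
have /eqP -> : count (ltn^~ k) (iota 1 k.-1) == k.-1.
  rewrite -[X in _ == X](size_iota 1) -all_count; apply/allP => x.
  by rewrite mem_iota add1n prednK // => /andP[].
have -> : count (ltn^~ k) (iota k (size s - k.-1)) = 0.
  apply/eqP; rewrite -leqn0 leqNgt -has_count; apply/hasPn => x.
  by rewrite mem_iota => /andP[kx _]; rewrite -leqNgt.
by rewrite addn0 prednK.
Qed.

Lemma order_isomorphic_eq (s t : permutation) : order_isomorphic s t -> s = t.
Proof.
move=> /order_isomorphicP[sst h]; apply/val_inj/(@eq_from_nth _ 0) => //= i hi.
rewrite [LHS]nth_permutation // [RHS]nth_permutation -?sst //; congr _.+1.
by apply: eq_in_count => j; rewrite mem_iota => /andP[_ hj]; exact: h.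
Qed.

Lemma contains_pattern_refl : reflexive contains_pattern.
Proof.
by move=> s; apply/contains_patternP; exists s; rewrite ?order_isomorphic_refl.
Qed.

Lemma contains_pattern_anti : antisymmetric contains_pattern.
Proof.
move=> s t /andP[/contains_patternP[u ut us] /contains_patternP[v vs vt]].
have /order_isomorphicP[su _] := us; have /order_isomorphicP[sv _] := vt.
suff eut : u = t by apply/esym/order_isomorphic_eq; rewrite -eut.
apply/eqP; rewrite -(size_subseq_leqif ut) eqn_leq (size_subseq ut) /=.
by rewrite su -sv size_subseq.
Qed.

Lemma contains_pattern_trans : transitive contains_pattern.
Proof.
move=> t s r /contains_patternP[u /subseqP[m _ ->] us].
move=> /contains_patternP[v vr vt]; apply/contains_patternP.
exists (mask m v); first exact: subseq_trans (mask_subseq m v) vr.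
exact: order_isomorphic_trans (order_isomorphic_mask m vt) us.
Qed.

Fact pattern_display : Order.disp_t. Proof. exact: Order.Disp tt tt. Qed.

HB.instance Definition _ :=
  Order.Le_isPOrder.Build pattern_display permutation
    contains_pattern_refl contains_pattern_anti contains_pattern_trans.

Definition pattern_interval (s t : permutation) : Type :=
  {p : permutation | (s <= p <= t)%O}.

HB.instance Definition _ s t := SubChoice.on (pattern_interval s t).
HB.instance Definition _ s t :=
  [SubChoice_isSubPOrder of pattern_interval s t by <: with pattern_display].

Definition poset_isomorphic d d' (T : porderType d) (T' : porderType d') : Prop :=
  exists2 f : T -> T', bijective f & {mono f : x y / (x <= y)%O}.

Definition largest_letter (w : seq nat) : nat := \max_(x <- w) x.

Lemma largest_letter_permutation (s : permutation) :
  largest_letter s = size s.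
Proof.
case/andP: (wordP s) => s0 ps; rewrite /largest_letter (perm_big _ ps) /=.
apply/eqP; rewrite eqn_leq; apply/andP; split.
  by apply/bigmax_leqP_seq => x; rewrite mem_iota add1n ltnS => /andP[].
have nI : size s \in iota 1 (size s) by rewrite mem_iota s0 add1n ltnS /=.
exact: (@leq_bigmax_seq _ _ xpredT id _ nI).
Qed.

Definition direct_sum_word (a b : seq nat) : seq nat :=
  a ++ [seq largest_letter a + x | x <- b].

Definition skew_sum_word (a b : seq nat) : seq nat :=
  [seq largest_letter b + x | x <- a] ++ b.

Lemma direct_sum_wordP (a b : permutation) :
  is_permutation (direct_sum_word a b).
Proof.
case/andP: (wordP a) => a0 pa; case/andP: (wordP b) => _ pb.
rewrite /is_permutation /direct_sum_word size_cat size_map addn_gt0 a0 /=.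
rewrite largest_letter_permutation iotaD addnC iotaDl.
by apply: perm_cat => //; apply: perm_map.
Qed.

Lemma skew_sum_wordP (a b : permutation) :
  is_permutation (skew_sum_word a b).
Proof.
have := direct_sum_wordP b a.
rewrite /is_permutation /skew_sum_word /direct_sum_word !size_cat size_map.
by rewrite [X in iota 1 X]addnC [X in 0 < X]addnC perm_catC.
Qed.

Definition direct_sum (a b : permutation) : permutation :=
  Permutation (direct_sum_wordP a b).

Definition skew_sum (a b : permutation) : permutation :=
  Permutation (skew_sum_wordP a b).

Declare Scope permutation_scope.
Delimit Scope permutation_scope with perm.
Notation "a ⊕ b" := (direct_sum a b)
  (at level 50, left associativity) : permutation_scope.
Notation "a ⊖ b" := (skew_sum a b)
  (at level 50, left associativity) : permutation_scope.
Local Open Scope permutation_scope.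

Definition indecomposable (p : permutation) : Prop :=
  ~ exists a b : permutation, p = a ⊕ b.

Definition skew_indecomposable (p : permutation) : Prop :=
  ~ exists a b : permutation, p = a ⊖ b.

(* Main.v *)
Require Import Defs.
From mathcomp Require Import all_boot all_order.
Local Open Scope permutation_scope.

(** Part (a) holds because p |-> alpha ⊕ p is itself the isomorphism.

    It preserves and reflects containment for every alpha
    ([direct_sum_le_mono]): an occurrence of alpha ⊕ p in alpha ⊕ q puts its
    i-th letter at position i or later, so the part playing p lies in q.

    It reaches all of [alpha ⊕ sigma, alpha ⊕ tau]
    ([direct_sum_interval_onto]).  Suppose alpha ⊕ sigma <= q <= alpha ⊕ tau.
    An occurrence of q in alpha ⊕ tau cuts q into a prefix lying in alpha and a
    suffix lying in tau, every letter of the prefix being smaller than every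
    letter of the suffix.  Take an occurrence of alpha ⊕ sigma in q.  It cannot
    start in the suffix, for then alpha ⊕ sigma <= tau.  So it starts in the
    prefix, and the copy of alpha cannot straddle the cut, for then alpha would
    be a direct sum.  Hence the prefix contains alpha; as it is also contained
    in alpha, it is order isomorphic to alpha, and q = alpha ⊕ p.

    The other parts are mirror images.  Complementing letters and reversing
    words are involutive automorphisms of the pattern poset; the first turns
    direct sums into skew sums, the second turns a direct sum into a skew sum
    with the summands exchanged.  [translates_intervals] states part (a) for an
    arbitrary binary operation, and [translates_intervals_transport] carries it
    along such an automorphism. *)

(** * Order isomorphism of words *)

Lemma order_isomorphic_sym {u v} : order_isomorphic u v -> order_isomorphic v u.
Proof.
move=> /order_isomorphicP[suv huv]; apply/order_isomorphicP.
by split=> // i j hi hj; rewrite huv // suv.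
Qed.

Lemma order_isomorphic_map_add n u : order_isomorphic (map (addn n) u) u.
Proof.
apply/order_isomorphicP; rewrite size_map; split=> // i j hi hj.
by rewrite !(nth_map 0) // ltn_add2l.
Qed.

Lemma order_isomorphic_take k {u v} :
  order_isomorphic u v -> order_isomorphic (take k u) (take k v).
Proof.
move=> /order_isomorphicP[suv huv]; apply/order_isomorphicP.
rewrite !size_take_min suv; split=> // i j.
by rewrite !leq_min -suv => /andP[ik iu] /andP[jk ju]; rewrite !nth_take ?huv.
Qed.

Lemma order_isomorphic_drop k {u v} :
  order_isomorphic u v -> order_isomorphic (drop k u) (drop k v).
Proof.
move=> /order_isomorphicP[suv huv]; apply/order_isomorphicP.
rewrite !size_drop suv; split=> // i j.
by rewrite !ltn_subRL -suv => iu ju; rewrite !nth_drop huv.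
Qed.

Lemma order_isomorphic_rev u v :
  order_isomorphic u v -> order_isomorphic (rev u) (rev v).
Proof.
move=> /order_isomorphicP[suv huv]; apply/order_isomorphicP.
rewrite !size_rev suv; split=> // i j; rewrite -suv => iu ju.
by rewrite !nth_rev -?suv // huv // ltn_subrL (leq_ltn_trans _ iu).
Qed.

Lemma order_isomorphic_map_sub c d u v :
  {in u, forall x, x <= c} -> {in v, forall x, x <= d} ->
  order_isomorphic u v -> order_isomorphic (map (subn c) u) (map (subn d) v).
Proof.
move=> uc vd /order_isomorphicP[suv huv]; apply/order_isomorphicP.
rewrite !size_map; split=> // i j iu ju; have [iv jv] := (iu, ju).
rewrite suv in iv jv.
rewrite !(nth_map 0) // !ltn_sub2lE ?huv //; first exact/vd/mem_nth.
exact/uc/mem_nth.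
Qed.

(** * Words cut into smaller letters followed by larger ones *)

Definition lower_prefix (k : nat) (w : seq nat) : Prop :=
  forall i j, i < k -> k <= j -> j < size w -> nth 0 w i < nth 0 w j.

Lemma lower_prefix_order_isomorphic {k u v} :
  order_isomorphic u v -> lower_prefix k u -> lower_prefix k v.
Proof.
move=> /order_isomorphicP[suv huv] lu i j ik kj jv.
rewrite -huv ?suv //; first by apply: lu; rewrite ?suv.
exact: leq_ltn_trans (ltnW (leq_trans ik kj)) jv.
Qed.

Lemma lower_prefix_cat {u v} :
  {in u & v, forall x y, x < y} -> lower_prefix (size u) (u ++ v).
Proof.
move=> uv i j iu uj; rewrite size_cat !nth_cat iu (ltnNge j (size u)) uj /= => jv.
by apply: uv; rewrite mem_nth // ltn_subLR.
Qed.

Lemma order_isomorphic_cat u1 u2 v1 v2 :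
  {in u1 & u2, forall x y, x < y} -> {in v1 & v2, forall x y, x < y} ->
  order_isomorphic u1 v1 -> order_isomorphic u2 v2 ->
  order_isomorphic (u1 ++ u2) (v1 ++ v2).
Proof.
move=> lu lv /order_isomorphicP[s1 h1] /order_isomorphicP[s2 h2].
have lt_u := lower_prefix_cat lu; have lt_v := lower_prefix_cat lv.
apply/order_isomorphicP; rewrite !size_cat s1 s2; split=> // i j iu ju.
have [i1|i1] := ltnP i (size u1); have [j1|j1] := ltnP j (size u1).
- by rewrite !nth_cat -s1 i1 j1 h1.
- by rewrite lt_u ?lt_v -?s1 // ?s1 ?size_cat ?s1 ?s2.
- have ltu := lt_u j i j1 i1; have ltv := lt_v j i.
  rewrite size_cat s1 s2 in ltu; rewrite size_cat -s1 in ltv.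
  rewrite ltnNge [RHS]ltnNge (ltnW (ltu iu)) (ltnW (ltv j1 i1 _)) //.
  by rewrite s1.
- rewrite !nth_cat -s1 (ltnNge i (size u1)) i1 (ltnNge j (size u1)) j1 /=.
  by rewrite h2 // ltn_subLR // s1 s2.
Qed.

Lemma letter_bounds {s : permutation} {x} : x \in word s -> 0 < x <= size s.
Proof.
by case/andP: (wordP s) => _ ps; rewrite (perm_mem ps) mem_iota add1n ltnS.
Qed.

Lemma direct_sum_letters {a b : permutation} {w : seq nat} :
  subseq w b ->
  {in word a & map (addn (largest_letter a)) w, forall x y, x < y}.
Proof.
move=> wb x y /letter_bounds/andP[_ xa] /mapP[z zw ->].
have /letter_bounds/andP[z0 _] := mem_subseq wb zw.
by rewrite largest_letter_permutation -addn1 leq_add.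
Qed.

(** The letters of the prefix are the k smallest of 1, ..., n: sorting prefix
    and suffix separately sorts the whole word, into 1, ..., n. *)
Lemma lower_prefix_direct_sum {q : permutation} {k} :
  0 < k < size q -> lower_prefix k q ->
  exists a b : permutation, size a = k /\ q = a ⊕ b.
Proof.
move=> /andP[k0 kn] lq; case/andP: (wordP q) => _ pq.
have stk : size (take k q) = k by rewrite size_takel // ltnW.
have lt_td : {in take k q & drop k q, forall x y, x < y}.
  move=> x y /(nthP 0)[i]; rewrite stk => ik <- /(nthP 0)[j].
  rewrite size_drop ltn_subRL => jk <-; rewrite nth_take // nth_drop.
  by apply: lq; rewrite // leq_addr.
have E : sort leq (take k q) ++ sort leq (drop k q) = iota 1 (size q).
  apply: (sorted_eq leq_trans anti_leq); last 2 first.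
  - exact: iota_sorted.
  - apply: perm_trans pq; rewrite -[X in perm_eq _ X](cat_take_drop k).
    by apply: perm_cat; rewrite perm_sort.
  rewrite (sorted_pairwise leq_trans) pairwise_cat -!(sorted_pairwise leq_trans).
  rewrite !sort_sorted ?andbT; try exact: leq_total.
  apply/allrelP => x y; rewrite !mem_sort => xt yd.
  exact/ltnW/lt_td.
have szE : size q = k + (size q - k) by rewrite subnKC // ltnW.
rewrite szE iotaD in E.
have /eqP := E; rewrite eqseq_cat ?size_sort ?size_iota // => /andP[/eqP Et /eqP Ed].
have at_perm : is_permutation (take k q).
  by rewrite /is_permutation stk k0 -Et perm_sym perm_sort perm_refl.
pose b := map (subn^~ k) (drop k q).
have qb : drop k q = map (addn k) b.
  rewrite -map_comp -[LHS]map_id; apply/eq_in_map => x xd /=.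
  rewrite subnKC //; move: xd; rewrite -(mem_sort leq) Ed mem_iota add1n.
  by move=> /andP[/ltnW].
have b_perm : is_permutation b.
  rewrite /is_permutation size_map size_drop subn_gt0 kn /=.
  apply: (perm_map_inj (@addnI k)); rewrite -qb -iotaDl addnC -Ed perm_sym.
  by rewrite perm_sort perm_refl.
exists (Permutation at_perm), (Permutation b_perm); split=> //.
apply: val_inj; rewrite /= /direct_sum_word.
by rewrite (largest_letter_permutation (Permutation at_perm)) /= stk -qb cat_take_drop.
Qed.

(** * Translation by a direct summand *)

Lemma contains_pattern_subseq {s t : permutation} {u w} :
  subseq u w -> order_isomorphic w t -> order_isomorphic u s -> (s <= t)%O.
Proof.
move=> /subseqP[m _ ->] wt us; apply/contains_patternP.
exists (mask m t); first exact: mask_subseq.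
exact/(order_isomorphic_trans _ us)/order_isomorphic_mask/order_isomorphic_sym.
Qed.

Lemma direct_sum_le_mono (a : permutation) :
  {mono direct_sum a : p q / (p <= q)%O}.
Proof.
move=> p q; apply/idP/idP => [/contains_patternP[u] | /contains_patternP[u uq up]].
  move=> /subseqP[m sm ->]; set n := largest_letter a.
  rewrite /= /direct_sum_word -/n => /(order_isomorphic_drop (size a)).
  rewrite drop_size_cat // => iso.
  have {iso} := order_isomorphic_trans iso (order_isomorphic_map_add n p).
  apply: contains_pattern_subseq (order_isomorphic_map_add n q).
  rewrite -[m](cat_take_drop (size a)) mask_cat; last first.
    by rewrite size_takel // sm size_cat leq_addr.
  (* at most |a| of the letters of the occurrence come from a, so dropping
     |a| letters removes all of these *)
  rewrite drop_cat ltnNge size_subseq ?mask_subseq //=.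
  exact: subseq_trans (drop_subseq _ _) (mask_subseq _ _).
apply/contains_patternP; exists (a ++ map (addn (largest_letter a)) u).
  by rewrite cat_subseq // map_subseq.
apply: order_isomorphic_cat; rewrite ?order_isomorphic_refl //.
- exact: direct_sum_letters uq.
- exact: direct_sum_letters (subseq_refl p).
apply: order_isomorphic_trans (order_isomorphic_map_add _ _) _.
exact: order_isomorphic_trans up (order_isomorphic_sym (order_isomorphic_map_add _ _)).
Qed.

(** Write k for the number of letters of q that an occurrence of q in a ⊕ t
    places in a.  An occurrence of a ⊕ s in q starts among these k letters,
    since a ⊕ s is not contained in t, and its copy of a ends among them, since
    a is indecomposable.  So k = |a|, and the cut of q at k splits off a. *)
Lemma direct_sum_interval_onto {a s t q : permutation} :
  indecomposable a -> ~ (a ⊕ s <= t)%O -> (a ⊕ s <= q <= a ⊕ t)%O ->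
  exists p, q = a ⊕ p.
Proof.
move=> a_indec nle /andP[/contains_patternP[u uq iu] /contains_patternP[v vat iv]].
set n := largest_letter a in iu vat.
have [v1 [v2 [Ev v1a v2t]]] : exists v1 v2,
    [/\ v = v1 ++ v2, subseq v1 a & subseq v2 (map (addn n) t)].
  have /subseqP[m sm Em] := vat.
  exists (mask (take (size a) m) a), (mask (drop (size a) m) (map (addn n) t)).
  rewrite !mask_subseq -mask_cat ?cat_take_drop //.
  by rewrite size_takel // sm size_cat leq_addr.
set k := size v1.
have ka : k <= size a := size_subseq v1a.
have szv : size v = size q by case/order_isomorphicP: iv.
have kq : k <= size q by rewrite -szv Ev size_cat leq_addr.
have lq : lower_prefix k q.
  apply: (lower_prefix_order_isomorphic iv); rewrite Ev.
  apply: lower_prefix_cat => x y /(mem_subseq v1a) xa /(mem_subseq v2t).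
  exact: direct_sum_letters (subseq_refl t) x y xa.
have [u1 [u2 [Eu u1q u2q]]] : exists u1 u2,
    [/\ u = u1 ++ u2, subseq u1 (take k q) & subseq u2 (drop k q)].
  have /subseqP[m sm Em] := uq.
  exists (mask (take k m) (take k q)), (mask (drop k m) (drop k q)).
  rewrite !mask_subseq -mask_cat ?cat_take_drop //.
  by rewrite !size_takel ?sm.
have lk : size u1 <= k by rewrite (leq_trans (size_subseq u1q)) // size_takel.
have szu : size u = size a + size s.
  by case/order_isomorphicP: iu => ->; rewrite size_cat size_map.
have s0 : 0 < size s by case/andP: (wordP s).
have ak : size a <= k.
  apply: leq_trans lk; case: (posnP (size u1)) => [u10|u10].
    (* the occurrence of a ⊕ s lies in the suffix, which is order isomorphic to
       v2, a subsequence of the shifted t *)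
    have /subseqP[m _ Em] := u2q.
    have := order_isomorphic_mask m (order_isomorphic_drop k iv).
    rewrite Ev drop_size_cat // -Em => iso.
    rewrite Eu (size0nil u10) cat0s in iu; case: nle.
    apply: (contains_pattern_subseq (subseq_trans (mask_subseq m v2) v2t)).
      exact: order_isomorphic_map_add.
    exact: order_isomorphic_trans iso iu.
  rewrite leqNgt; apply/negP => lt_a; apply: a_indec.
  suff la : lower_prefix (size u1) a.
    have [|b [c [_ ->]]] := lower_prefix_direct_sum _ la; first exact/andP.
    by exists b, c.
  have lu : lower_prefix (size u1) u.
    rewrite Eu; apply: lower_prefix_cat => x y.
    move=> /(mem_subseq u1q)/(nthP 0)[i]; rewrite size_takel // => ik <-.
    move=> /(mem_subseq u2q)/(nthP 0)[j]; rewrite size_drop ltn_subRL => jk <-.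
    by rewrite nth_take // nth_drop lq // leq_addr.
  move=> i j il lj ja; have := lower_prefix_order_isomorphic iu lu i j il lj.
  rewrite size_cat ltn_addr // !nth_cat ja (ltn_trans (leq_trans il lj) ja).
  exact.
have Ek : k = size a by apply/eqP; rewrite eqn_leq ka.
have k0 : 0 < k by rewrite Ek; case/andP: (wordP a).
have kn : k < size q.
  by rewrite (leq_trans _ (size_subseq uq)) // szu Ek -addn1 leq_add2l.
have [|b [p [szb Eq]]] := lower_prefix_direct_sum _ lq; first by rewrite k0.
exists p; rewrite Eq; congr (_ ⊕ _); apply/esym/order_isomorphic_eq.
have := order_isomorphic_take k iv.
rewrite Ev Eq take_size_cat // take_size_cat //.
suff -> : v1 = a by [].
by apply/eqP; rewrite -(size_subseq_leqif v1a) -Ek.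
Qed.

(** * Intervals and their translations *)

(** An order embedding of the whole poset restricts to an isomorphism of
    intervals as soon as it misses no element of the target. *)
Lemma interval_isomorphism {f : permutation -> permutation} {s t : permutation} :
  {mono f : p q / (p <= q)%O} ->
  (forall q, (f s <= q <= f t)%O -> exists p, q = f p) ->
  poset_isomorphic (pattern_interval s t) (pattern_interval (f s) (f t)).
Proof.
move=> f_mono f_onto.
have f_in (p : pattern_interval s t) : (f s <= f (val p) <= f t)%O.
  by rewrite !f_mono; exact: valP p.
pose F (p : pattern_interval s t) : pattern_interval (f s) (f t) :=
  exist _ (f (val p)) (f_in p).
have F_mono : {mono F : x y / (x <= y)%O} by move=> x y; exact: f_mono.
have F_onto (y : pattern_interval (f s) (f t)) : exists x, F x == y.
  have [p Ep] := f_onto _ (valP y).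
  have p_in : (s <= p <= t)%O by have := valP y; rewrite Ep !f_mono.
  by exists (exist _ p p_in); apply/eqP/val_inj; rewrite /= Ep.
exists F => //; exists (fun y => xchoose (F_onto y)) => [x|y]; last first.
  exact/eqP/(xchooseP (F_onto y)).
exact/(Order.POrderTheory.inc_inj F_mono)/eqP/(xchooseP (F_onto (F x))).
Qed.

Lemma poset_isomorphic_trans {d1 d2 d3} {T1 : porderType d1} {T2 : porderType d2}
    {T3 : porderType d3} :
  poset_isomorphic T1 T2 -> poset_isomorphic T2 T3 -> poset_isomorphic T1 T3.
Proof.
move=> [f f_bij f_mono] [g g_bij g_mono]; exists (g \o f); first exact: bij_comp.
by move=> x y; rewrite /= g_mono f_mono.
Qed.

(** Part (a) with an arbitrary operation in place of the direct sum: the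
    operations of interest are the two sums and the two sums with their
    arguments exchanged. *)
Definition translates_intervals
    (op : permutation -> permutation -> permutation) : Prop :=
  forall a s t : permutation,
  ~ (exists b c, a = op b c) -> ~ (op a s <= t)%O ->
  poset_isomorphic (pattern_interval s t) (pattern_interval (op a s) (op a t)).

Lemma direct_sum_translates_intervals : translates_intervals direct_sum.
Proof.
move=> a s t a_indec nle.
apply: (interval_isomorphism (direct_sum_le_mono a)) => q.
exact: direct_sum_interval_onto a_indec nle.
Qed.

Lemma translates_intervals_transport {h : permutation -> permutation} {op op'} :
  involutive h -> {mono h : p q / (p <= q)%O} ->
  {morph h : a b / op a b >-> op' a b} ->
  translates_intervals op -> translates_intervals op'.
Proof.
move=> hK h_mono h_op op_trans a s t a_indec nle.
have h_iso p q : poset_isomorphic (pattern_interval p q)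
                                  (pattern_interval (h p) (h q)).
  by apply: (interval_isomorphism h_mono) => r _; exists (h r); rewrite hK.
have op'E b c : op' b c = h (op (h b) (h c)) by rewrite h_op !hK.
rewrite !op'E; apply: poset_isomorphic_trans (h_iso s t) _.
apply: poset_isomorphic_trans (op_trans (h a) _ _ _ _) (h_iso _ _).
  by move=> [b [c Ea]]; apply: a_indec; exists (h b), (h c); rewrite -h_op -Ea hK.
by rewrite -h_mono hK -op'E.
Qed.

(** * Reversal and complement *)

Lemma mono_of_involutive_homo {h : permutation -> permutation} :
  involutive h -> {homo h : p q / (p <= q)%O} -> {mono h : p q / (p <= q)%O}.
Proof. by move=> hK h_homo p q; apply/idP/idP => /h_homo; rewrite ?hK. Qed.

Lemma reverse_wordP (s : permutation) : is_permutation (rev s).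
Proof. by rewrite /is_permutation size_rev perm_rev; exact: wordP. Qed.

Definition reverse (s : permutation) : permutation :=
  Permutation (reverse_wordP s).

Lemma reverseK : involutive reverse.
Proof. by move=> s; apply/val_inj/revK. Qed.

Lemma reverse_le_mono : {mono reverse : p q / (p <= q)%O}.
Proof.
apply: (mono_of_involutive_homo reverseK) => p q /contains_patternP[u uq up].
apply/contains_patternP; exists (rev u); first by rewrite subseq_rev.
exact: order_isomorphic_rev.
Qed.

Lemma reverse_skew_sum (a b : permutation) :
  reverse (a ⊖ b) = reverse b ⊕ reverse a.
Proof.
apply: val_inj; rewrite /= /direct_sum_word /skew_sum_word rev_cat map_rev.
by rewrite (largest_letter_permutation (reverse b)) largest_letter_permutation
           size_rev.
Qed.

Lemma reverse_direct_sum (a b : permutation) :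
  reverse (a ⊕ b) = reverse b ⊖ reverse a.
Proof. by apply: (can_inj reverseK); rewrite reverse_skew_sum !reverseK. Qed.

Lemma complement_wordP (s : permutation) :
  is_permutation (map (subn (size s).+1) s).
Proof.
case/andP: (wordP s) => s0 ps; rewrite /is_permutation size_map s0 /=.
set n := size s in ps *; set c := subn n.+1.
have c_in x : x \in iota 1 n -> c x \in iota 1 n.
  rewrite !mem_iota add1n !ltnS => /andP[x0 xn].
  by rewrite subn_gt0 ltnS xn leq_subLR -add1n leq_add2r.
have cK : {in iota 1 n, cancel c c}.
  by move=> x; rewrite mem_iota add1n ltnS => /andP[_ xn]; rewrite /c subKn 1?leqW.
apply: perm_trans (perm_map _ ps) _; apply: uniq_perm; rewrite ?iota_uniq //.
  by rewrite (map_inj_in_uniq (can_in_inj cK)) iota_uniq.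
move=> x; apply/mapP/idP => [[y /c_in yn ->] // | xn].
by exists (c x); rewrite ?c_in ?cK.
Qed.

Definition complement (s : permutation) : permutation :=
  Permutation (complement_wordP s).

Lemma complementK : involutive complement.
Proof.
move=> s; apply: val_inj; rewrite /= size_map -map_comp -[RHS]map_id.
apply/eq_in_map => x /letter_bounds/andP[_ xs].
by rewrite /= subKn // leqW.
Qed.

Lemma complement_le_mono : {mono complement : p q / (p <= q)%O}.
Proof.
apply: (mono_of_involutive_homo complementK) => p q /contains_patternP[u uq up].
apply/contains_patternP; exists (map (subn (size q).+1) u).
  exact: map_subseq.
apply: order_isomorphic_map_sub up => x.
  by move=> /(mem_subseq uq)/letter_bounds/andP[_ /leqW].
by move=> /letter_bounds/andP[_ /leqW].
Qed.

Lemma complement_direct_sum (a b : permutation) :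
  complement (a ⊕ b) = complement a ⊖ complement b.
Proof.
apply: val_inj; rewrite /= /direct_sum_word /skew_sum_word.
rewrite (largest_letter_permutation (complement b)) largest_letter_permutation.
rewrite map_cat size_cat !size_map -!map_comp; congr (_ ++ _).
  apply/eq_in_map => x /letter_bounds/andP[_ xa] /=.
  by rewrite addnC -addnS addnBA // leqW.
by apply/eq_map => x /=; rewrite -addnS subnDl.
Qed.

(** * Summands of either kind on either side *)

Theorem theorem6p1 (sigma tau alpha beta gamma delta : permutation)
    (alpha_indec : indecomposable alpha)
    (gamma_indec : indecomposable gamma)
    (beta_indec : skew_indecomposable beta)
    (delta_indec : skew_indecomposable delta) :
  [/\ (* (a) *) ~ (alpha ⊕ sigma <= tau)%O ->
        poset_isomorphic (pattern_interval sigma tau)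
                         (pattern_interval (alpha ⊕ sigma) (alpha ⊕ tau)),
      (* (b) *) ~ (beta ⊖ sigma <= tau)%O ->
        poset_isomorphic (pattern_interval sigma tau)
                         (pattern_interval (beta ⊖ sigma) (beta ⊖ tau)),
      (* (c) *) ~ (sigma ⊕ gamma <= tau)%O ->
        poset_isomorphic (pattern_interval sigma tau)
                         (pattern_interval (sigma ⊕ gamma) (tau ⊕ gamma))
    & (* (d) *) ~ (sigma ⊖ delta <= tau)%O ->
        poset_isomorphic (pattern_interval sigma tau)
                         (pattern_interval (sigma ⊖ delta) (tau ⊖ delta))].
Proof.
have skewl : translates_intervals skew_sum.
  apply: translates_intervals_transport complementK complement_le_mono _
    direct_sum_translates_intervals.
  exact: complement_direct_sum.
have skewr : translates_intervals (fun a s => s ⊖ a).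
  apply: translates_intervals_transport reverseK reverse_le_mono _
    direct_sum_translates_intervals.
  exact: reverse_direct_sum.
have dirr : translates_intervals (fun a s => s ⊕ a).
  apply: translates_intervals_transport reverseK reverse_le_mono _ skewl.
  exact: reverse_skew_sum.
split.
- exact: direct_sum_translates_intervals.
- exact: skewl.
- by apply: dirr => -[b [c E]]; apply: gamma_indec; exists c, b.
- by apply: skewr => -[b [c E]]; apply: delta_indec; exists c, b.
Qed.
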